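(* Let $(\mathfrak X,\|\cdot\|)$ be a Banach space and let $\mu$ be a Borel probability measure on $\mathfrak X$ with $\int_{\mathfrak X}\|x\|\,\mu(dx)<\infty$. Then for every $n\in\mathbb N$ $$e_n^{\mathrm{ran}}\ge\tfrac18\cdot n^{1/2}\cdot\sup_{m\ge4n}\,(q_{m-1}-q_m),$$ where $e_n^{\mathrm{ran}}$ is the $n$-th minimal worst case error of (broad sense) randomized algorithms for integrating Lipschitz functionals with respect to $\mu$, $q_m$ is the $m$-th quantization number of $\mu$ of order one, and the supremum is over integers $m\ge 4n$.
   Context: $\mathbb N=\{1,2,\dots\}$. $F$ denotes the class of all functionals $f:\mathfrak X\to\mathbb R$ with $|f(x)-f(y)|\le\|x-y\|$ for all $x,y\in\mathfrak X$, and $S(f)=\int_{\mathfrak X}f(x)\,\mu(dx)$ for $f\in F$. Deterministic algorithms. $\mathbb S^{\mathrm{det}}$ is the class of all mappings $\widehat S:F\to\mathbb R$ arising as follows from a point $x_1\in\mathfrak X$ and arbitrary mappings $\psi_\ell:\mathbb R^{\ell-1}\to\mathfrak X$ ($\ell\ge2$), $\tau_\ell:\mathbb R^\ell\to\{0,1\}$ ($\ell\ge1$), $\phi_\ell:\mathbb R^\ell\to\mathbb R$ ($\ell\ge1$). For $f\in F$ put $y_1=f(x_1)$ and $y_\ell=f(\psi_\ell(y_1,\dots,y_{\ell-1}))$ for $\ell\ge2$; let $n(f)=\min\{\ell\ge1:\tau_\ell(y_1,\dots,y_\ell)=1\}$, which is assumed to be finite for every $f\in F$; then $\widehat S(f)=\phi_{n(f)}(y_1,\dots,y_{n(f)})$.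 The mapping $\widehat S$ is identified with these data, and $\mathrm{card}(\widehat S,f)=n(f)$. Randomized algorithms. $\mathbb S^{\mathrm{ran}}$ is the class of all mappings $\widehat S:\Omega\times F\to\mathbb R$, on any probability space $(\Omega,\mathfrak A,P)$, such that (i) $\widehat S(\omega,\cdot)\in\mathbb S^{\mathrm{det}}$ for every $\omega\in\Omega$; (ii) $\widehat S(\cdot,f)$ is measurable for every $f\in F$; (iii) $\omega\mapsto\mathrm{card}(\widehat S(\omega,\cdot),f)$ is measurable for every $f\in F$. The random variables in (ii), (iii) are written $\widehat S(f)$ and $\mathrm{card}(\widehat S,f)$. Define $e(\widehat S)=\sup_{f\in F}(\mathbb E|S(f)-\widehat S(f)|^2)^{1/2}$ and $\mathrm{card}(\widehat S)=\sup_{f\in F}\mathbb E(\mathrm{card}(\widehat S,f))$ (for simplicity assumed to belong to $\mathbb N$), and $$e_n^{\mathrm{ran}}=\inf\{e(\widehat S):\widehat S\in\mathbb S^{\mathrm{ran}},\ \mathrm{card}(\widehat S)\le n\}.$$ Quantization numbers. $q_n=\inf_{x_1,\dots,x_n\in\mathfrak X}\int_{\mathfrak X}\min_{i=1,\dots,n}\|x-x_i\|\,\mu(dx)$. *)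

(* Defs.v *)
(* MathComp / MathComp-Analysis *)
From HB Require Import structures.
From mathcomp Require Export all_boot all_order all_algebra.
From mathcomp Require Export all_classical all_reals all_analysis.
Export Order.TTheory GRing.Theory Num.Theory.
Export numFieldNormedType.Exports.

Set Implicit Arguments.
Unset Strict Implicit.
Unset Printing Implicit Defensive.

Local Open Scope classical_set_scope.
Local Open Scope ring_scope.
Local Open Scope ereal_scope.

Definition borel_space {T : topologicalType} := g_sigma_algebraType (@open T).
Arguments borel_space T : clear implicits.

Section LipschitzFunctionals.
Context {R : realType} (X : normedModType R).

Record lip1 := Lip1 {
  lip1_fun :> X -> R ;
  lip1P : forall x y : X, (`|lip1_fun x - lip1_fun y| <= `|x - y|)%R
}.

End LipschitzFunctionals.

Section DeterministicAlgorithms.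
Context {R : realType} {X : normedModType R}.

(* [observations x1 psi f l] is the tuple (y_1, ..., y_{l+1}). *)
Fixpoint observations (x1 : X) (psi : forall l, l.+1.-tuple R -> X)
    (f : X -> R) (l : nat) : l.+1.-tuple R :=
  match l with
  | 0%N => [tuple f x1]
  | l'.+1 => let y := observations x1 psi f l' in rcons_tuple y (f (psi l' y))
  end.

End DeterministicAlgorithms.

(* The maps psi_(l+2), tau_(l+1), phi_(l+1), which all take l+1 arguments, are
   [det_psi l], [det_tau l], [det_phi l]; [true] plays the role of 1. *)
Record det_alg (R : realType) (X : normedModType R) := DetAlg {
  det_start : X ;
  det_psi : forall l, l.+1.-tuple R -> X ;
  det_tau : forall l, l.+1.-tuple R -> bool ;
  det_phi : forall l, l.+1.-tuple R -> R ;
  det_stops : forall f : lip1 X,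
    exists l, det_tau (observations det_start det_psi f l)
}.

Section DeterministicAlgorithmsTheory.
Context {R : realType} {X : normedModType R}.
Implicit Types (S : det_alg X) (f : lip1 X).

Definition det_obs S f (l : nat) : l.+1.-tuple R :=
  observations (det_start S) (@det_psi _ _ S) f l.

(* n(f) - 1 *)
Definition det_last S f : nat := ex_minn (det_stops S f).

Definition det_card S f : nat := (det_last S f).+1.

Definition det_eval S f : R := det_phi S (det_obs S f (det_last S f)).

End DeterministicAlgorithmsTheory.

Record ran_alg (R : realType) (X : normedModType R) d (Omega : measurableType d)
  := RanAlg {
  ran_det :> Omega -> det_alg X ;
  ran_eval_measurable : forall f : lip1 X,
    measurable_fun [set: Omega] (fun w => det_eval (ran_det w) f) ;
  ran_card_measurable : forall f : lip1 X,
    measurable_fun [set: Omega] (fun w => det_card (ran_det w) f)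
}.

Section MinimalErrors.
Context {R : realType} {X : normedModType R}.
Variable mu : probability (borel_space X) R.

Definition lip_integral (f : lip1 X) : R := (\int[mu]_x f x)%R.

Definition ran_error d (Omega : measurableType d) (P : probability Omega R)
    (S : ran_alg X Omega) : \bar R :=
  ereal_sup [set sqrte
    'E_P[fun w => (`|lip_integral f - det_eval (S w) f| ^+ 2)%R]
    | f in [set: lip1 X]].

Definition ran_cost d (Omega : measurableType d) (P : probability Omega R)
    (S : ran_alg X Omega) : \bar R :=
  ereal_sup [set 'E_P[fun w => ((det_card (S w) f)%:R)%R] | f in [set: lip1 X]].

(* Only algorithms whose worst case expected cost is a positive integer are
   admitted. *)
Definition min_ran_error (n : nat) : \bar R :=
  ereal_inf [set r | exists d (Omega : measurableType d)
      (P : probability Omega R) (S : ran_alg X Omega),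
    (exists2 k : nat, (1 <= k <= n)%N & ran_cost P S = k%:R%:E) /\
    r = ran_error P S].

(* The unit +oo of the iterated minimum plays no role for 0 < n. *)
Definition quantization_number (n : nat) : \bar R :=
  ereal_inf [set \int[mu]_x \big[mine/+oo]_(i < n) (`|(x : X) - c i|)%R%:E
    | c in [set: 'I_n -> X]].

End MinimalErrors.

(* Main.v *)
Require Import Defs.
From mathcomp Require Import measurable_realfun zify lra.

(** Write [m] for the number of quantization points.  The proof plants [m]
small Lipschitz bumps, one around each point of a nearly optimal quantizer
[c], and hides a random sign in front of each of them.

The bump at [c i] is half the amount by which the distance to the set of
points grows when [c i] is dropped.  It is supported in the Voronoi cell of
[c i], so the bumps are disjoint; by the triangle inequality two bumps
satisfy [bump_add_le], which makes every signed sum of bumps 1-Lipschitz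
([signed_bumps_lip]).  Dropping [c i] leaves a quantizer with [m - 1] points,
hence the integral of each bump is at least about half of the difference of
consecutive quantization numbers ([bump_integral]).

An algorithm that evaluates such a signed sum at one point sees at most one
sign.  After a run of cost [p] at least [m - p] signs are still unseen, and
flipping an unseen one changes nothing that the algorithm observes
([revealed_flip]).  Hence each unseen sign is uncorrelated with all other
contributions to the error, and if every bump has integral at least [delta],
then the mean square error over all signs is at least [delta ^ 2] times
[m] minus the mean cost ([sum_sqr_error_ge], [det_sum_sqr_error_ge]).  This
bound is linear in the cost, so it can be integrated over the randomness of
the algorithm: with expected cost at most [n], some choice of signs has mean
square error at least [delta ^ 2 * (m - n)] ([ran_error_ge]).  For
[m >= 4 * n] this is at least [delta ^ 2 * n], and [delta] can be taken to be
a quarter of the difference of the quantization numbers. *)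

Local Open Scope ring_scope.

(** * Random signs and flips *)

Definition flip {T : finType} (i : T) (e : {ffun T -> bool}) :=
  [ffun j => (j == i) (+) e j].

Lemma flipK {T : finType} (i : T) : involutive (flip i).
Proof. by move=> e; apply/ffunP => j; rewrite !ffunE addbA addbb. Qed.

(** Pair each [e] with [flip i e]: the two terms cancel. *)
Lemma sum_sign_flip_invariant {R : realDomainType} {T : finType} (i : T)
    (h : {ffun T -> bool} -> R) :
  (forall e, h (flip i e) = h e) ->
  \sum_(e : {ffun T -> bool}) (-1) ^+ e i * h e = 0.
Proof.
move=> hi; set s := \sum_e _.
suff sN : s = - s by lra.
rewrite {1}/s (reindex_inj (inv_inj (flipK i))) /= -sumrN.
by apply: eq_bigr => e _; rewrite hi ffunE eqxx /= signrN mulNr.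
Qed.

(** Here [K e] stands for the signs that are known when [e] is the hidden sign
pattern and [s e] for the guess of the signed sum of [a].  The hypothesis says
that neither depends on the unknown signs, which are thus still uniformly
distributed; the guess cannot do better than the variance they contribute. *)
Lemma sum_sqr_error_ge {R : realDomainType} {T : finType} (a : T -> R)
    (K : {ffun T -> bool} -> {set T}) (s : {ffun T -> bool} -> R) :
  (forall e i, i \notin K e -> K (flip i e) = K e /\ s (flip i e) = s e) ->
  \sum_(e : {ffun T -> bool}) \sum_(i in ~: K e) a i ^+ 2
    <= \sum_(e : {ffun T -> bool}) (\sum_i (-1) ^+ e i * a i - s e) ^+ 2.
Proof.
move=> Ks.
pose c (e : {ffun T -> bool}) := \sum_(i in K e) (-1) ^+ e i * a i - s e.
(* With [U] the part of the sum over unknown signs, the squared error is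
   [(c + U) ^ 2], at least [U * (2 * c + U)].  Splitting off the diagonal terms
   [a i ^ 2] leaves in front of each unknown sign [i] the factor [h i], which
   does not involve that sign. *)
pose h i (e : {ffun T -> bool}) := (i \in ~: K e)%:R * a i *
  (2 * c e + \sum_(j in ~: K e | j != i) (-1) ^+ e j * a j).
have h_flip i e : h i (flip i e) = h i e.
  rewrite /h; case: (boolP (i \in K e)) => iK; last first.
    have [EK Es] := Ks _ _ iK; rewrite /c EK Es; congr (_ * (2 * (_ - _) + _)).
      apply: eq_bigr => j jK; rewrite ffunE; case: eqP => // ji.
      by rewrite -ji jK in iK.
    by apply: eq_bigr => j /andP[_ /negPf ji]; rewrite ffunE ji.
  have iK' : i \in K (flip i e).
    apply: contraT => iN; have [EK _] := Ks _ _ iN.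
    by rewrite flipK in EK; rewrite -EK iK in iN.
  by rewrite !inE iK iK' !mul0r.
have sum_h : \sum_(e : {ffun T -> bool}) \sum_i (-1) ^+ e i * h i e = 0.
  by rewrite exchange_big big1 // => i _; apply: sum_sign_flip_invariant.
rewrite -[leLHS]addr0 -[X in _ + X]sum_h -big_split /=; apply: ler_sum => e _.
rewrite [X in (X - _) ^+ 2](bigID (mem (K e))) /= addrAC -/(c e).
pose U := \sum_(i in ~: K e) (-1) ^+ e i * a i.
have -> : \sum_(i | ~~ mem (K e) i) (-1) ^+ e i * a i = U.
  by apply: eq_bigl => i; rewrite finset.in_setC.
suff -> : \sum_(i in ~: K e) a i ^+ 2 + \sum_i (-1) ^+ e i * h i e
    = U * (2 * c e + U) by have := sqr_ge0 (c e); lra.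
rewrite [X in _ + X](bigID (mem (~: K e))) /= [X in _ + (_ + X)]big1 ?addr0.
  rewrite -big_split /= /U mulr_suml; apply: eq_bigr => i iK.
  rewrite /h iK mul1r (bigD1 i iK) /=.
  have := sqrr_sign R (e i); set sg := (-1) ^+ _; nra.
by move=> i /negPf iK; rewrite /h iK !mul0r mulr0.
Qed.

(** * Locality of deterministic algorithms *)

Section Locality.
Context {R : realType} {X : normedModType R} (S : det_alg X).
Implicit Types f g : lip1 X.

(** The point at which the algorithm evaluates [f] in order to obtain the last
entry of [det_obs S f k]. *)
Definition query f (k : nat) : X :=
  match k with
  | 0%N => det_start S
  | k'.+1 => det_psi S (det_obs S f k')
  end.

Lemma det_obs_local f g l :
    (forall k, (k <= l)%N -> f (query f k) = g (query f k)) ->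
  det_obs S g l = det_obs S f l.
Proof.
elim: l => [|l IHl] fg; first by congr [tuple _]; rewrite (fg 0%N).
have E : det_obs S g l = det_obs S f l by apply: IHl => k /leqW; apply: fg.
have /= := fg l.+1 (leqnn _); move: E; rewrite /det_obs /= => -> fgl.
by congr (rcons_tuple _ _).
Qed.

Lemma det_lastP f : det_tau S (det_obs S f (det_last S f)) /\
  forall l, det_tau S (det_obs S f l) -> (det_last S f <= l)%N.
Proof. by rewrite /det_last; case: ex_minnP => p; split. Qed.

(** A run depends on the functional only through its values at the points
queried before stopping. *)
Lemma det_run_local f g :
    (forall k, (k <= det_last S f)%N -> f (query f k) = g (query f k)) ->
  [/\ det_last S g = det_last S f, det_eval S g = det_eval S f &
      forall k, (k <= det_last S f)%N -> query g k = query f k].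
Proof.
move=> fg.
have obsE l : (l <= det_last S f)%N -> det_obs S g l = det_obs S f l.
  by move=> lf; apply: det_obs_local => k kl; apply: fg (leq_trans kl lf).
have lastE : det_last S g = det_last S f.
  have [tau_f f_min] := det_lastP f; have [tau_g g_min] := det_lastP g.
  have gf : (det_last S g <= det_last S f)%N by apply: g_min; rewrite obsE.
  by apply/eqP; rewrite eqn_leq gf f_min // -obsE.
split=> //; first by rewrite /det_eval lastE obsE.
by case=> // k kf /=; rewrite obsE // ltnW.
Qed.

Context {m : nat} (b : 'I_m -> X -> R) (G : {ffun 'I_m -> bool} -> lip1 X).
Hypothesis b_disj : forall i j x, b i x != 0 -> b j x != 0 -> i = j.
Hypothesis G_sum : forall e x, G e x = \sum_i (-1) ^+ e i * b i x.

Definition revealed (e : {ffun 'I_m -> bool}) : {set 'I_m} :=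
  [set i | [exists k : 'I_(det_card S (G e)), b i (query (G e) k) != 0]].

(** The bumps are disjoint, so each query reveals at most one sign. *)
Lemma card_revealed e : (#|revealed e| <= det_card S (G e))%N.
Proof.
pose bump_at (k : 'I_(det_card S (G e))) := [pick i | b i (query (G e) k) != 0].
rewrite -[leqRHS]card_ord -(card_imset _ (@Some_inj _)).
apply: leq_trans (leq_imset_card bump_at predT).
apply: subset_leq_card; apply/fintype.subsetP => _ /imsetP[i]
  /[!inE] /existsP[k bi] ->.
apply/imsetP; exists k => //; rewrite /bump_at.
by case: pickP => [j bj|/(_ i)]; [rewrite (b_disj _ _ _ bi bj)|rewrite bi].
Qed.

(** Flipping an unrevealed sign leaves the functional unchanged at every queried
point, so the whole run is the same. *)
Lemma revealed_flip e i : i \notin revealed e ->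
  [/\ revealed (flip i e) = revealed e,
      det_eval S (G (flip i e)) = det_eval S (G e)
    & det_card S (G (flip i e)) = det_card S (G e)].
Proof.
rewrite inE negb_exists => /forallP ri.
have [|lastE evalE queryE] := @det_run_local (G e) (G (flip i e)).
  move=> k ke; rewrite !G_sum; apply: eq_bigr => j _; rewrite ffunE.
  case: eqP => [->|//].
  have := ri (Ordinal (ke : (k < det_card S (G e))%N)).
  by rewrite negbK /= => /eqP ->; rewrite !mulr0.
split=> //; last by rewrite /det_card lastE.
apply/setP => j; rewrite !inE /det_card lastE.
apply: eq_existsb => k; rewrite queryE // -ltnS; exact: ltn_ord.
Qed.

(** The cost is kept as a summand instead of being subtracted from [m]: all
terms are then nonnegative, which is what integration over random algorithms
requires. *)
Lemma det_sum_sqr_error_ge (a : 'I_m -> R) (delta : R) :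
    0 <= delta -> (forall i, delta <= a i) ->
  delta ^+ 2 * m%:R * #|{ffun 'I_m -> bool}|%:R <=
  \sum_(e : {ffun 'I_m -> bool})
     ((\sum_i (-1) ^+ e i * a i - det_eval S (G e)) ^+ 2
      + delta ^+ 2 * (det_card S (G e))%:R).
Proof.
move=> delta0 delta_a; rewrite big_split /=.
have err_ge := @sum_sqr_error_ge _ _ a revealed (fun e => det_eval S (G e))
  (fun e i ri => let: And3 K E _ := revealed_flip e i ri in conj K E).
apply: le_trans (lerD err_ge (lexx _)); rewrite -big_split /=.
rewrite -[X in _ * X%:R]sum1_card natr_sum mulr_sumr.
apply: ler_sum => e _; rewrite mulr1.
have : m%:R <= #|~: revealed e|%:R + (det_card S (G e))%:R :> R.
  by rewrite -natrD ler_nat -[m in leqLHS]card_ord -(cardsC (revealed e)) addnC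
    leq_add2l card_revealed.
move=> /(ler_wpM2l (sqr_ge0 delta)); rewrite mulrDr => /le_trans; apply.
rewrite lerD2r -sum1_card natr_sum mulr_sumr; apply: ler_sum => i _.
by rewrite mulr1 lerXn2r // nnegrE // (le_trans delta0).
Qed.

End Locality.

(** * Bumps separating the points of a quantizer *)

Section Bumps.
Context {R : realType} {X : normedModType R}.

(** The distance to a nonempty finite family of points.  The unit of the
iterated minimum is one of the candidates, which keeps the value real. *)
Definition dist_to {k} (c : 'I_k.+1 -> X) (x : X) : R :=
  \big[Num.min/ `|x - c ord0|]_(j < k.+1) `|x - c j|.

Lemma dist_to_le {k} (c : 'I_k.+1 -> X) j x : dist_to c x <= `|x - c j|.
Proof. exact: bigmin_le. Qed.

Lemma dist_to_attained {k} (c : 'I_k.+1 -> X) x :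
  exists j, dist_to c x = `|x - c j|.
Proof.
rewrite /dist_to; elim/big_ind: _ => [|u v [i ->] [j ->]|i _]; last by exists i.
  by exists ord0.
by rewrite /Num.min; case: ifP => _; [exists i | exists j].
Qed.

Lemma EFin_dist_to {k} (c : 'I_k.+1 -> X) x :
  (\big[mine/+oo]_(j < k.+1) (`|x - c j|)%:E = (dist_to c x)%:E)%E.
Proof.
apply/eqP; rewrite eq_le; apply/andP; split.
  by have [j ->] := dist_to_attained c x; apply: bigmin_le.
by apply: le_bigmin => [|j _]; rewrite ?leey // lee_fin dist_to_le.
Qed.

Lemma dist_to_lip {k} (c : 'I_k.+1 -> X) (x y : X) :
  `|dist_to c x - dist_to c y| <= `|x - y|.
Proof.
wlog : x y / dist_to c y <= dist_to c x => [th|yx].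
  case: (leP (dist_to c y) (dist_to c x)) => [/th//|/ltW /th].
  by rewrite distrC (distrC y).
rewrite ger0_norm ?subr_ge0 //; have [j ->] := dist_to_attained c y.
rewrite lerBlDr; apply: le_trans (dist_to_le c j x) _.
by rewrite -[x - c j](subrKA y) ler_normD.
Qed.

Definition dist_lip {k} (c : 'I_k.+1 -> X) : lip1 X := Lip1 (dist_to_lip c).

(** Without the factor one half a bump is only 2-Lipschitz, since both distances
may vary at full speed in opposite directions. *)
Definition bump {k} (c : 'I_k.+2 -> X) (i : 'I_k.+2) (x : X) : R :=
  (dist_to (c \o lift i) x - dist_to c x) / 2.

Section FixedQuantizer.
Context {k : nat} (c : 'I_k.+2 -> X).

Lemma bump_ge0 i x : 0 <= bump c i x.
Proof.
rewrite divr_ge0 // subr_ge0.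
by have [j ->] := dist_to_attained (c \o lift i) x; apply: dist_to_le.
Qed.

(** A nonzero bump at [x] means that [c i] is the nearest point to [x], so
dropping [c i] increases the distance to at most [`|x - c j|]. *)
Lemma bump_le i j x : j != i -> bump c i x != 0 ->
  2 * bump c i x <= `|x - c j| - `|x - c i|.
Proof.
move=> ji; rewrite /bump [2 * _]mulrC divfK ?pnatr_eq0 // => bi.
have [l dl] := dist_to_attained c x.
have li : l = i.
  apply/eqP/negPn/negP => /negP li; case: (unliftP i l) => [l' ll'|/eqP//].
  have := bump_ge0 i x; rewrite /bump in bi *.
  have := dist_to_le (c \o lift i) l' x; rewrite /= -ll' -dl => H1 H2.
  by move/eqP: bi; apply; lra.
case: (unliftP i j) ji => [j' -> _|->]; last by rewrite eqxx.
by rewrite dl li lerB // (dist_to_le (c \o lift i) j').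
Qed.

(** Adding [bump_le] at [x] and at [y] compares each of the two centers with
both points; the triangle inequality then bounds the sum. *)
Lemma bump_add_le i j x y : i != j -> bump c i x != 0 -> bump c j y != 0 ->
  bump c i x + bump c j y <= `|x - y|.
Proof.
move=> ij bi bj; have := bump_le j i y ij bj.
rewrite eq_sym in ij; have := bump_le i j x ij bi.
have : `|x - c j| <= `|x - y| + `|y - c j|.
  by rewrite -[x - c j](subrKA y) ler_normD.
have : `|y - c i| <= `|y - x| + `|x - c i|.
  by rewrite -[y - c i](subrKA x) ler_normD.
rewrite (distrC y x); lra.
Qed.

Lemma bump_disjoint i j x : bump c i x != 0 -> bump c j x != 0 -> i = j.
Proof.
move=> bi bj; apply/eqP/negPn/negP => ij.
have := bump_add_le i j x x ij bi bj; rewrite subrr normr0.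
have := bump_ge0 j x; have : 0 < bump c i x by rewrite lt_def bi bump_ge0.
lra.
Qed.

Lemma bump_lip i x y : `|bump c i x - bump c i y| <= `|x - y|.
Proof.
have := dist_to_lip c x y; have := dist_to_lip (c \o lift i) x y.
rewrite /bump !ler_norml => /andP[? ?] /andP[? ?]; apply/andP; split; lra.
Qed.

Definition signed_bumps (e : {ffun 'I_k.+2 -> bool}) x :=
  \sum_i (-1) ^+ e i * bump c i x.

Lemma signed_bumps_one e i x : (forall j, bump c j x != 0 -> j = i) ->
  signed_bumps e x = (-1) ^+ e i * bump c i x.
Proof.
move=> only_i; rewrite /signed_bumps (bigD1 i) //= big1 ?addr0 // => j ji.
have [->|/only_i jE] := eqVneq (bump c j x) 0; first by rewrite mulr0.
by rewrite jE eqxx in ji.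
Qed.

(** Choosing an arbitrary index where all bumps vanish avoids a case
distinction in the proof of [signed_bumps_lip]. *)
Lemma exists_only_bump x : exists i, forall j, bump c j x != 0 -> j = i.
Proof.
case: (pickP (fun i => bump c i x != 0)) => [i bi|no_bump].
  by exists i => j bj; apply: bump_disjoint bj bi.
by exists ord0 => j; rewrite no_bump.
Qed.

Lemma signed_bumps_lip e x y :
  `|signed_bumps e x - signed_bumps e y| <= `|x - y|.
Proof.
have [i ix] := exists_only_bump x; have [j jy] := exists_only_bump y.
rewrite (signed_bumps_one _ _ _ ix) (signed_bumps_one _ _ _ jy).
have norm_sg l z : `|(-1) ^+ e l * bump c l z| = bump c l z.
  by rewrite normrMsign ger0_norm // bump_ge0.
have [<-|ij] := eqVneq i j; first by rewrite -mulrBr normrMsign bump_lip.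
have [bi|bi] := eqVneq (bump c i x) 0.
  have xj : bump c j x = 0.
    by apply/eqP/negPn/negP => /ix ji; rewrite ji eqxx in ij.
  by rewrite bi mulr0 sub0r normrN norm_sg -[leLHS]ger0_norm ?bump_ge0 //
    -[bump c j y]subr0 -xj distrC bump_lip.
have [bj|bj] := eqVneq (bump c j y) 0.
  have yi : bump c i y = 0.
    by apply/eqP/negPn/negP => /jy ji; rewrite ji eqxx in ij.
  by rewrite bj mulr0 subr0 norm_sg -[leLHS]ger0_norm ?bump_ge0 //
    -[bump c i x]subr0 -yi bump_lip.
apply: le_trans (ler_normB _ _) _; rewrite !norm_sg; exact: bump_add_le.
Qed.

Definition signed_bumps_lip1 e : lip1 X := Lip1 (signed_bumps_lip e).

End FixedQuantizer.
End Bumps.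

(** * Integrals of Lipschitz functionals *)

Section Integrals.
Context {R : realType} {X : normedModType R} (mu : probability (borel_space X) R).
Hypothesis mu_moment : (\int[mu]_x (`|(x : X)|)%R%:E < +oo)%E.

Lemma lip1_continuous (f : lip1 X) : continuous f.
Proof.
move=> x; apply/cvgrPdist_le => e e0; near=> y.
apply: le_trans (lip1P f x y) _; near: y.
exact: cvgr_dist_le e0.
Unshelve. all: by end_near. Qed.

(** The sigma-algebra of [borel_space X] is generated by the open sets, so
continuity suffices. *)
Lemma lip1_measurable (f : lip1 X) :
  measurable_fun [set: borel_space X] (f : borel_space X -> R).
Proof.
apply: (measurability _ (RGenOpens.measurableE R)).
move=> _ [_ [a [b ->]] <-]; rewrite setTI.
apply: sub_sigma_algebra; apply: open_comp; last exact: interval_open.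
by move=> x _; apply: lip1_continuous.
Qed.

Lemma norm_lip (x y : X) : `| `|x| - `|y| | <= `|x - y|.
Proof. exact: ler_dist_dist. Qed.

(** The first moment of [mu] is finite and [`|f x| <= `|x| + `|f 0|]. *)
Lemma lip1_integrable (f : lip1 X) :
  mu.-integrable [set: borel_space X] (EFin \o f).
Proof.
have norm_int : mu.-integrable [set: borel_space X]
    (EFin \o (fun x : X => `|x|)).
  apply/integrableP; split.
    apply/measurable_EFinP; exact: (lip1_measurable (Lip1 norm_lip)).
  by under eq_integral => x _ do rewrite /= normr_id.
have bound_int : mu.-integrable [set: borel_space X]
    ((EFin \o (fun x : X => `|x|%R)) \+ (EFin \o cst `|f 0%R|%R))%E.
  by apply: integrableD => //; apply: finite_measure_integrable_cst.
apply: le_integrable bound_int => //.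
  by apply/measurable_EFinP; exact: lip1_measurable.
move=> x _; rewrite /= lee_fin [leRHS]ger0_norm ?addr_ge0 //.
rewrite -lerBlDr; apply: le_trans (lerB_dist _ _) _.
by rewrite -[x in leRHS]subr0 lip1P.
Qed.

Lemma EFin_lip_integral (f : lip1 X) :
  ((lip_integral mu f)%:E = \int[mu]_x (f x)%:E)%E.
Proof.
by rewrite /lip_integral /Rintegral fineK // integrable_fin_num //
  lip1_integrable.
Qed.

Lemma quantization_numberE k : quantization_number mu k.+1 =
  ereal_inf [set (lip_integral mu (dist_lip c))%:E | c in [set: 'I_k.+1 -> X]].
Proof.
congr ereal_inf; apply: eq_imagel => c _; rewrite EFin_lip_integral.
by apply: eq_integral => x _; rewrite EFin_dist_to.
Qed.

Lemma quantization_number_fin k : quantization_number mu k.+1 \is a fin_num.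
Proof.
rewrite quantization_numberE fin_numE; apply/andP; split.
  rewrite -ltNye; apply: (@lt_le_trans _ _ 0%E); first by rewrite ltNy0.
  apply/ereal_infP => _ [c _ <-]; rewrite EFin_lip_integral.
  apply: integral_ge0 => x _; rewrite lee_fin /=.
  by have [j ->] := dist_to_attained c x.
rewrite -ltey; apply: (@le_lt_trans _ _
  (lip_integral mu (dist_lip (fun _ : 'I_k.+1 => 0%R)))%:E).
  by apply: ereal_inf_lbound; exists (fun=> 0%R).
exact: ltry.
Qed.

Lemma bump_integrable {k} (c : 'I_k.+2 -> X) i :
  mu.-integrable [set: borel_space X] (EFin \o bump c i).
Proof.
exact: (lip1_integrable (Lip1 (bump_lip c i))).
Qed.

(** Both integrals on the right are quantization errors, for one point less
and for all points. *)
Lemma bump_integral {k} (c : 'I_k.+2 -> X) i :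
  (\int[mu]_x bump c i x)%R =
  (lip_integral mu (dist_lip (c \o lift i)) - lip_integral mu (dist_lip c)) / 2.
Proof.
have lift_int := lip1_integrable (dist_lip (c \o lift i)).
have full_int := lip1_integrable (dist_lip c).
rewrite /bump RintegralZr ?RintegralB //.
exact: (integrableB measurableT lift_int full_int).
Qed.

Lemma signed_bumps_integral {k} (c : 'I_k.+2 -> X) e :
  lip_integral mu (signed_bumps_lip1 c e) =
  \sum_i (-1) ^+ e i * (\int[mu]_x bump c i x)%R.
Proof.
apply: EFin_inj; rewrite EFin_lip_integral /= /signed_bumps.
under eq_integral => x _ do rewrite -sumEFin.
rewrite integral_sum //; last first.
  move=> i; under eq_fun => x do rewrite EFinM.
  exact/integrableZl/bump_integrable.
rewrite -sumEFin; apply: eq_bigr => i _.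
under eq_integral => x _ do rewrite EFinM.
rewrite integralZl //; last exact: bump_integrable.
by rewrite EFinM /Rintegral fineK // integrable_fin_num //;
  apply: bump_integrable.
Qed.

End Integrals.

(** * Randomized algorithms against random signs *)

Section Randomized.
Context {R : realType} {X : normedModType R} (mu : probability (borel_space X) R).
Hypothesis mu_moment : (\int[mu]_x (`|(x : X)|)%R%:E < +oo)%E.
Context {d : measure_display} {Omega : measurableType d}
  (P : probability Omega R) (S : ran_alg X Omega).

Definition sqr_error (f : lip1 X) (w : Omega) : R :=
  `|lip_integral mu f - det_eval (S w) f| ^+ 2.

Definition card_at (f : lip1 X) (w : Omega) : R := (det_card (S w) f)%:R.

Lemma measurable_sqr_error f : measurable_fun [set: Omega] (sqr_error f).
Proof.
apply: measurable_funX; apply: measurableT_comp => //.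
by apply: measurable_funB => //; apply: ran_eval_measurable.
Qed.

Lemma measurable_card_at f : measurable_fun [set: Omega] (card_at f).
Proof.
by apply: (measurableT_comp (f := fun k : nat => k%:R : R)) => //;
  apply: ran_card_measurable.
Qed.

Lemma ran_error_ge0 : (0 <= ran_error mu P S)%E.
Proof.
pose f := dist_lip (fun _ : 'I_1 => 0 : X).
apply: le_trans (sqrte_ge0 _) _; last by apply: ereal_sup_ubound; exists f.
Qed.

Context {k : nat} (c : 'I_k.+2 -> X) (delta : R).
Hypothesis delta_ge0 : 0 <= delta.
Hypothesis delta_le : forall i, delta <= (\int[mu]_x bump c i x)%R.

Notation G := (signed_bumps_lip1 c).
Notation signs := {ffun 'I_k.+2 -> bool}.

(** The sum over signs is finite, so it can be taken inside the expectation,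
where [det_sum_sqr_error_ge] applies to each realization. *)
Lemma sum_expectation_ge :
  ((delta ^+ 2 * k.+2%:R * #|signs|%:R)%:E <=
   \sum_(e : signs) ('E_P[sqr_error (G e)] +
     (delta ^+ 2)%:E * 'E_P[card_at (G e)]))%E.
Proof.
have m_err e : measurable_fun [set: Omega] (EFin \o sqr_error (G e)).
  by apply/measurable_EFinP; apply: measurable_sqr_error.
have m_card e : measurable_fun [set: Omega] (EFin \o card_at (G e)).
  by apply/measurable_EFinP; apply: measurable_card_at.
pose h (e : signs) w : \bar R :=
  ((sqr_error (G e) w)%:E + (delta ^+ 2)%:E * (card_at (G e) w)%:E)%E.
have m_h e : measurable_fun [set: Omega] (h e).
  exact: (emeasurable_funD (m_err e)
    (measurable_funeM (delta ^+ 2)%:E (m_card e))).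
have h_ge0 e w : (0 <= h e w)%E.
  by rewrite /h -EFinM -EFinD lee_fin addr_ge0 ?mulr_ge0 ?sqr_ge0 ?ler0n.
have -> : (\sum_(e : signs) ('E_P[sqr_error (G e)] +
     (delta ^+ 2)%:E * 'E_P[card_at (G e)]) =
   \int[P]_w \sum_(e : signs) h e w)%E.
  rewrite (ge0_integral_sum P measurableT m_h (fun e w _ => h_ge0 e w)).
  apply: eq_bigr => e _.
  have card_ge0 w : [set: Omega]%classic w -> (0 <= (EFin \o card_at (G e)) w)%E.
    by rewrite lee_fin ler0n.
  rewrite unlock -(ge0_integralZl_EFin P measurableT card_ge0 (m_card e)
    (sqr_ge0 delta)).
  rewrite -(ge0_integralD P measurableT _ (m_err e) _
    (measurable_funeM _ (m_card e))) //.
    by move=> w _; rewrite lee_fin sqr_ge0.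
  by move=> w _; rewrite -EFinM lee_fin mulr_ge0 ?sqr_ge0 ?ler0n.
rewrite -[leLHS]mule1 -(probability_setT P) -integral_cst //.
apply: ge0_le_integral => //.
- by move=> w _; rewrite lee_fin !mulr_ge0 ?sqr_ge0 ?ler0n.
- by apply: emeasurable_sum.
move=> w _; rewrite /h; under eq_bigr => e _ do rewrite -EFinM -EFinD.
rewrite sumEFin lee_fin.
have := @det_sum_sqr_error_ge _ _ (S w) _ (bump c) G (bump_disjoint c)
  (fun _ _ => erefl) _ _ delta_ge0 delta_le.
move=> /le_trans; apply; apply: ler_sum => e _.
by rewrite /sqr_error real_normK ?num_real // signed_bumps_integral.
Qed.

(** The worst case error is at least the root mean square error over uniform
random signs. *)
Lemma ran_error_ge (n : nat) : (n <= k.+2)%N -> (ran_cost P S <= n%:R%:E)%E ->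
  (sqrte (delta ^+ 2 * (k.+2 - n)%:R)%:E <= ran_error mu P S)%E.
Proof.
move=> nk cost_n; set B := delta ^+ 2 * _.
have B0 : 0 <= B by rewrite mulr_ge0 ?sqr_ge0 ?ler0n.
suff [e Be] : exists e, (B%:E <= 'E_P[sqr_error (G e)])%E.
  apply: (@le_trans _ _ (sqrte 'E_P[sqr_error (G e)])%E).
    by rewrite lee_sqrt // (le_trans _ Be).
  by apply: ereal_sup_ubound; exists (G e).
(* If all errors were smaller, their sum would violate [sum_expectation_ge]. *)
apply: contrapT => /forallNP small.
have card_n e : ('E_P[card_at (G e)] <= n%:R%:E)%E.
  by apply: le_trans cost_n; apply: ereal_sup_ubound; exists (G e).
pose v e := fine 'E_P[sqr_error (G e)]%E.
have vE e : ('E_P[sqr_error (G e)] = (v e)%:E)%E.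
  rewrite fineK // ge0_fin_numE; last first.
    by apply: expectation_ge0 => w; apply: sqr_ge0.
  by have /negP := small e; rewrite -ltNge => /lt_trans; apply; rewrite ltry.
have vB e : v e < B by rewrite -lte_fin -vE ltNge; apply/negP.
have : \sum_(e : signs) v e < \sum_(e : signs) B.
  by apply: ltr_sum => //; apply/hasP; exists [ffun=> false];
    rewrite ?mem_index_enum.
apply/negP; rewrite -leNgt.
have : delta ^+ 2 * k.+2%:R * #|signs|%:R <=
    \sum_(e : signs) (v e + delta ^+ 2 * n%:R).
  rewrite -lee_fin -sumEFin; apply: le_trans sum_expectation_ge _.
  apply: lee_sum => e _; rewrite vE EFinD (EFinM (delta ^+ 2)); apply: leeD2l.
  by apply: lee_wpmul2l => //; rewrite lee_fin sqr_ge0.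
have sum_cst (u : R) : \sum_(e : signs) u = u * #|signs|%:R.
  by rewrite sumr_const mulr_natr.
rewrite big_split /= !sum_cst /B natrB //.
move: (#|signs|%:R : R) (k.+2%:R : R) (n%:R : R) (\sum_e v e) => *; lra.
Qed.

End Randomized.

Local Open Scope classical_set_scope.
Local Open Scope ring_scope.
Local Open Scope ereal_scope.

Theorem theorem3 (R : realType) (X : completeNormedModType R)
    (mu : probability (borel_space X) R)
    (mu_moment : \int[mu]_x (`|(x : X)|)%R%:E < +oo)
    (n : nat) (n_ge1 : (1 <= n)%N) :
  ((8%:R)^-1 * Num.sqrt n%:R)%R%:E *
    ereal_sup [set quantization_number mu m.-1 - quantization_number mu m
              | m in [set m : nat | (4 * n <= m)%N]]
  <= min_ran_error mu n.
Proof.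
apply/ereal_infP => _ [d [W [P [S [[N /andP[_ Nn] cost] ->]]]]].
rewrite -ereal_sup_pZl; last first.
  by rewrite mulr_gt0 ?invr_gt0 ?ltr0n // sqrtr_gt0 ltr0n.
apply/ereal_supP => _ [_ [m mn <-] <-].
have [k mk] : exists k, m = k.+2 by exists m.-2; move: mn => /=; lia.
have kn : (n <= k.+2 - n)%N by move: mn => /=; lia.
rewrite {m mn}mk /=.
have := quantization_number_fin mu mu_moment k.
have := quantization_number_fin mu mu_moment k.+1.
case Eb : (quantization_number mu k.+2) => [b| |] // _.
case Ea : (quantization_number mu k.+1) => [a| |] // _.
rewrite -EFinB -EFinM.
have [ab|ba] := leP a b.
  apply: le_trans (ran_error_ge0 mu P S); rewrite lee_fin.
  by rewrite mulr_ge0_le0 ?subr_le0 // mulr_ge0 ?invr_ge0 ?sqrtr_ge0 ?ler0n.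
(* A quantizer that is optimal up to half of the gap: every bump integral then
   is at least a quarter of the gap. *)
have [_ [c _ <-]] : exists2 x, [set (lip_integral mu (dist_lip c))%:E
    | c in [set: 'I_k.+2 -> X]] x & x < b%:E + ((a - b) / 2)%R%:E.
  rewrite -Eb quantization_numberE //; apply: lb_ereal_inf_adherent.
    by rewrite divr_gt0 ?subr_gt0.
  by rewrite -quantization_numberE // Eb.
rewrite -EFinD lte_fin => c_opt.
have delta_le i : ((a - b) / 4 <= \int[mu]_x bump c i x)%R.
  have : (a%:E <= (lip_integral mu (dist_lip (c \o lift i)))%:E).
    rewrite -Ea quantization_numberE //.
    by apply: ereal_inf_lbound; exists (c \o lift i).
  rewrite bump_integral // lee_fin; lra.
have delta0 : (0 <= (a - b) / 4)%R by rewrite divr_ge0 // subr_ge0 ltW.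
have cost_n : ran_cost P S <= n%:R%:E by rewrite cost lee_fin ler_nat.
have n_le : (n <= k.+2)%N by lia.
apply: le_trans (ran_error_ge mu mu_moment P S c _ delta0 delta_le n n_le cost_n).
rewrite /= lee_fin sqrtrM ?sqr_ge0 // sqrtr_sqr ger0_norm //.
have : (Num.sqrt n%:R <= Num.sqrt (k.+2 - n)%:R :> R)%R.
  by rewrite ler_sqrt ?ler0n // ler_nat.
have : (0 <= Num.sqrt n%:R :> R)%R by apply: sqrtr_ge0.
nra.
Qed.
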